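(* Along any collision trajectory of the reduced two-body system with collision time $t^*$, one has $\dot q(t)\to-\infty$ and $p(t)\to-\infty$ as $t\to t^*$.
   Context: The reduced two-body system on $S^2$ (two identical bodies of mass $1$, potential $V(q)=-\cot q$, where $q\in(0,\pi)$ is the angle between the position vectors) is the following system of ODEs for $(m_1,m_2,m_3,q,p)\in\mathbb{R}^3\times(0,\pi)\times\mathbb{R}$: $$\dot m_1=\cot(q)\,(-m_2^2+m_3^2+2m_2m_3\cot q),\quad \dot m_2=m_1m_2\cot q-m_3(-2m_1+p+2m_1\csc^2 q),\quad \dot m_3=m_2p-m_1m_3\cot q,$$ $$\dot q=2p-m_1,\qquad \dot p=-\csc^2(q)\,(1+m_2m_3-2m_3^2\cot q).$$ It has the conserved quantities $\mathcal{C}=m_1^2+m_2^2+m_3^2$ (the Casimir function) and, with $\xi=\cot q$, $\mathcal{H}=\frac12\left(m_1^2+m_2^2-2m_1p+2p^2+\xi(-2-2m_2m_3+m_3^2\xi)+m_3^2(1+\xi^2)\right)$ (the Hamiltonian). A collision trajectory is a solution defined on $[0,t^* )$, $t^*\in(0,+\infty]$, with $q(t)\to0$ as $t\to t^*$; $t^*$ is called the collision time. *)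

(* Defs.v *)
From Stdlib Require Export Reals.
From Coquelicot Require Export Coquelicot.
Open Scope R_scope.

Definition cot (x : R) : R := cos x / sin x.
Definition csc (x : R) : R := / sin x.

(* Half-open time interval [0, tstar), with tstar possibly infinite. *)
Definition time_dom (tstar : Rbar) (t : R) : Prop :=
  0 <= t /\ Rbar_lt t tstar.

(* Derivative relative to [0, tstar): two-sided at interior times, and the
   right derivative at t = 0. *)
Definition is_derive_on (tstar : Rbar) (f : R -> R) (t l : R) : Prop :=
  filterdiff f (within (time_dom tstar) (locally t)) (fun h : R => scal h l).

(* The filter t -> tstar from below; it is [at_left] for a finite [tstar]. *)
Definition Rbar_at_left (tstar : Rbar) : (R -> Prop) -> Prop :=
  within (fun t : R => Rbar_lt t tstar) (Rbar_locally tstar).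

(* Values outside [0, tstar) are irrelevant. *)
Record reduced_solution (tstar : Rbar) (m1 m2 m3 q p : R -> R) : Prop := {
  rs_range : forall t, time_dom tstar t -> 0 < q t < PI;
  rs_m1 : forall t, time_dom tstar t ->
    is_derive_on tstar m1 t
      (cot (q t) * (- m2 t ^ 2 + m3 t ^ 2 + 2 * m2 t * m3 t * cot (q t)));
  rs_m2 : forall t, time_dom tstar t ->
    is_derive_on tstar m2 t
      (m1 t * m2 t * cot (q t)
       - m3 t * (- 2 * m1 t + p t + 2 * m1 t * csc (q t) ^ 2));
  rs_m3 : forall t, time_dom tstar t ->
    is_derive_on tstar m3 t (m2 t * p t - m1 t * m3 t * cot (q t));
  rs_q : forall t, time_dom tstar t ->
    is_derive_on tstar q t (2 * p t - m1 t);
  rs_p : forall t, time_dom tstar t ->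
    is_derive_on tstar p t
      (- csc (q t) ^ 2 * (1 + m2 t * m3 t - 2 * m3 t ^ 2 * cot (q t)))
}.

Record collision_trajectory (tstar : Rbar) (m1 m2 m3 q p : R -> R) : Prop := {
  ct_pos : Rbar_lt 0 tstar;
  ct_solution : reduced_solution tstar m1 m2 m3 q p;
  ct_collision : filterlim q (Rbar_at_left tstar) (locally 0)
}.

(* Main.v *)
Require Import Defs.
From Stdlib Require Import Reals Lra Psatz.
From Coquelicot Require Import Coquelicot.

(** The Casimir [C] and [h = H - C/2] are conserved.  Near the collision the
    function [G = sin q * q'] satisfies [G' >= 1], because all singular terms of
    [G'] except [2 cos^2 q / sin q] cancel against the energy.  Hence [q' <= 0]
    (otherwise [q] would increase from then on) and the collision time is finite.
    The quantity [W = m3 cos q - m2 sin q / 2], which plays the role of the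
    angular momentum, has [W' = sin q * m3 * (m1 - 3 q') / 4] and tends to [0],
    so integrating up to the collision, along which [sin q] decreases, gives
    [|W| <= K sin q].  Conservation of energy reads
    [q'^2 / 4 = h + (m1^2 + m2^2) / 4 + cot q - (W / sin q)^2], so [q'^2 -> oo]. *)

(** * Interior times and the filter at the collision time *)

Record solves_at (m1 m2 m3 q p : R -> R) (t : R) : Prop := {
  sa_range : 0 < q t < PI;
  sa_m1 : is_derive m1 t
    (cot (q t) * (- m2 t ^ 2 + m3 t ^ 2 + 2 * m2 t * m3 t * cot (q t)));
  sa_m2 : is_derive m2 t
    (m1 t * m2 t * cot (q t)
     - m3 t * (- 2 * m1 t + p t + 2 * m1 t * csc (q t) ^ 2));
  sa_m3 : is_derive m3 t (m2 t * p t - m1 t * m3 t * cot (q t));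
  sa_q : is_derive q t (2 * p t - m1 t);
  sa_p : is_derive p t
    (- csc (q t) ^ 2 * (1 + m2 t * m3 t - 2 * m3 t ^ 2 * cot (q t)))
}.

(** An interior time has a neighbourhood inside the domain, on which the restricted filter imposes
    nothing new. *)
Lemma is_derive_on_interior (tstar : Rbar) (f : R -> R) (t l : R) :
  0 < t -> Rbar_lt t tstar -> is_derive_on tstar f t l -> is_derive f t l.
Proof.
intros Ht Hts [Hlin Hdom].
split; [exact Hlin|].
intros x Hx.
assert (Hnbhd : locally t (time_dom tstar)).
{ apply (filter_imp (fun y : R => Rbar_lt 0 y /\ Rbar_lt y tstar)).
  - intros y [H1 H2]; split; [now apply Rlt_le|exact H2].
  - apply filter_and.
    + exact (open_Rbar_gt' t 0 Ht).
    + exact (open_Rbar_lt' t tstar Hts). }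
intros eps.
(* [filterdiff] quantifies over limits of the filter; a limit of [locally t] is also one of the
   finer restricted filter. *)
assert (Hlim : is_filter_lim (within (time_dom tstar) (locally t)) x).
{ intros P HP. unfold within.
  apply (filter_imp P); [now intros y Hy _|exact (Hx P HP)]. }
generalize (filter_and _ _ Hnbhd (Hdom x Hlim eps)).
apply filter_imp. intros y [H1 H2]. exact (H2 H1).
Qed.

Lemma solves_at_interior (tstar : Rbar) (m1 m2 m3 q p : R -> R) (t : R) :
  reduced_solution tstar m1 m2 m3 q p -> 0 < t -> Rbar_lt t tstar ->
  solves_at m1 m2 m3 q p t.
Proof.
intros [Hr H1 H2 H3 Hq Hp] Ht Hts.
assert (D : time_dom tstar t) by (split; [now apply Rlt_le|exact Hts]).
split; try (apply (is_derive_on_interior tstar); auto).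
now apply Hr.
Qed.

(** Expresses limits by thresholds, so that finite and infinite [tstar] are treated alike from here
    on. *)
Lemma Rbar_at_left_iff (tstar : Rbar) (P : R -> Prop) : Rbar_lt 0 tstar ->
  Rbar_at_left tstar P <->
  exists T, 0 < T /\ Rbar_lt T tstar /\
    forall t, T <= t -> Rbar_lt t tstar -> P t.
Proof.
intros Hpos.
unfold Rbar_at_left, within.
destruct tstar as [r| |]; simpl in *; [| |easy].
- split.
  + intros [d Hd].
    pose proof (cond_pos d).
    (* The entry [r / 2] only keeps the threshold positive, hence interior. *)
    assert (Rmax (r / 2) (r - d / 2) < r) by (apply Rmax_lub_lt; lra).
    pose proof (Rmax_l (r / 2) (r - d / 2)).
    pose proof (Rmax_r (r / 2) (r - d / 2)).
    exists (Rmax (r / 2) (r - d / 2)); split; [lra|split; [lra|]].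
    intros t H3 H4. apply Hd; [|exact H4].
    change (Rabs (t - r) < d). apply Rabs_lt_between'. lra.
  + intros [T [HT [HTr HP]]].
    assert (Hd : 0 < r - T) by lra.
    exists (mkposreal _ Hd). intros t Ht Htr.
    change (Rabs (t - r) < r - T) in Ht. apply Rabs_lt_between' in Ht.
    apply HP; lra.
- split.
  + intros [M HM].
    pose proof (Rmax_l 1 (M + 1)). pose proof (Rmax_r 1 (M + 1)).
    exists (Rmax 1 (M + 1)); split; [lra|split; [easy|]].
    intros t Ht _. apply HM; [lra|easy].
  + intros [T [HT [_ HP]]].
    exists T. intros t Ht _. apply HP; [lra|easy].
Qed.

(** * Monotonicity and constancy from derivatives *)

Lemma derive_nonneg_le (f df : R -> R) (a b : R) : a <= b ->
  (forall x, a <= x <= b -> is_derive f x (df x)) ->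
  (forall x, a <= x <= b -> 0 <= df x) -> f a <= f b.
Proof.
intros Hab Hd Hpos.
destruct (MVT_gen f a b df) as [c [Hc E]].
- intros x; rewrite Rmin_left, Rmax_right by exact Hab.
  intros Hx; apply Hd; lra.
- intros x; rewrite Rmin_left, Rmax_right by exact Hab.
  intros Hx. apply derivable_continuous_pt.
  exists (df x). apply is_derive_Reals. now apply Hd.
- rewrite Rmin_left, Rmax_right in Hc by exact Hab.
  specialize (Hpos c Hc). nra.
Qed.

Lemma Rbar_lt_between (tstar : Rbar) (x t : R) :
  x <= t -> Rbar_lt t tstar -> Rbar_lt x tstar.
Proof. intros H1 H2. now apply Rbar_le_lt_trans with (Finite t). Qed.

Lemma derive_zero_const (tstar : Rbar) (f : R -> R) :
  (forall t, 0 < t -> Rbar_lt t tstar -> is_derive f t 0) ->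
  forall a b, 0 < a -> 0 < b -> Rbar_lt a tstar -> Rbar_lt b tstar -> f a = f b.
Proof.
intros Hd.
assert (Hmono : forall a b, 0 < a -> a <= b -> Rbar_lt b tstar -> f a = f b).
{ intros a b Ha Hab Hb.
  assert (Hd' : forall x, a <= x <= b -> is_derive f x 0).
  { intros x Hx. apply Hd; [lra|].
    apply (Rbar_lt_between _ _ b); [lra|exact Hb]. }
  apply Rle_antisym.
  - apply (derive_nonneg_le f (fun _ => 0)); auto. intros; lra.
  - apply Ropp_le_cancel.
    apply (derive_nonneg_le (fun x => - f x) (fun _ => - 0)); auto.
    + intros x Hx. exact (is_derive_opp f x 0 (Hd' x Hx)).
    + intros; lra. }
intros a b Ha Hb Hats Hbts.
destruct (Rle_dec a b); [now apply Hmono|].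
symmetry. apply Hmono; auto; lra.
Qed.

(** * Trigonometric identities *)

Lemma csc_sqr (x : R) : sin x <> 0 -> csc x ^ 2 = 1 + cot x ^ 2.
Proof.
intros H. unfold csc, cot.
replace ((cos x / sin x) ^ 2) with ((cos x)² / sin x ^ 2)
  by (unfold Rsqr; field; exact H).
rewrite cos2. unfold Rsqr. field. exact H.
Qed.

(** Together with [csc_sqr] this leaves only [sin q] and [cot q] as atoms, so [field] can check the
    identities below. *)
Lemma cos_cot (x : R) : sin x <> 0 -> cos x = sin x * cot x.
Proof. intros H. unfold cot. field. exact H. Qed.

Lemma is_derive_cot (x : R) : sin x <> 0 -> is_derive cot x (- (1 + cot x ^ 2)).
Proof.
intros H. unfold cot.
evar_last; [auto_derive; [exact H|reflexivity]|].
field. exact H.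
Qed.

(** * Conserved and auxiliary quantities, and their derivatives *)

Definition casimir (m1 m2 m3 : R -> R) (t : R) : R :=
  m1 t ^ 2 + m2 t ^ 2 + m3 t ^ 2.

(* The Hamiltonian minus half the Casimir. *)
Definition energy (m1 m2 m3 q p : R -> R) (t : R) : R :=
  p t ^ 2 - m1 t * p t - cot (q t) * (1 + m2 t * m3 t)
  + m3 t ^ 2 * cot (q t) ^ 2.

(** The function [G] of the overview: minus the time derivative of [cos q]. *)
Definition radial (m1 q p : R -> R) (t : R) : R := sin (q t) * (2 * p t - m1 t).

(** The function [W] of the overview. *)
Definition angular (m2 m3 q : R -> R) (t : R) : R :=
  m3 t * cos (q t) - m2 t * sin (q t) / 2.

Section Derivatives.

Context (m1 m2 m3 q p : R -> R) (t : R) (Hs : solves_at m1 m2 m3 q p t).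

Lemma sin_q_pos : 0 < sin (q t).
Proof. destruct (sa_range _ _ _ _ _ _ Hs). now apply sin_gt_0. Qed.

Local Lemma sin_q_neq : sin (q t) <> 0.
Proof. apply Rgt_not_eq, sin_q_pos. Qed.

(** Differentiates formally, then replaces each remaining [Derive] by the right-hand side of its
    differential equation. *)
Ltac derive_along :=
  destruct Hs as [_ D1 D2 D3 Dq Dp];
  evar_last;
  [ auto_derive;
    [ repeat split; try (now eexists; eassumption) | reflexivity ]
  | repeat match goal with
    | D : is_derive ?f t _ |- context [Derive (fun x => ?f x) t] =>
        change (Derive (fun x => f x) t) with (Derive f t);
        rewrite (is_derive_unique f t _ D)
    end;
    rewrite ?(csc_sqr _ sin_q_neq) ].

Lemma is_derive_casimir : is_derive (casimir m1 m2 m3) t 0.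
Proof. unfold casimir. derive_along. ring. Qed.

Lemma is_derive_energy : is_derive (energy m1 m2 m3 q p) t 0.
Proof.
(* Naming [cot q] gives it a derivative [Dx] in the context, which [derive_along] uses like the
   equations of motion. *)
set (xi := fun u => cot (q u)).
assert (Dx : is_derive xi t (- (1 + cot (q t) ^ 2) * (2 * p t - m1 t))).
{ evar_last.
  - apply (is_derive_comp cot q).
    + apply is_derive_cot, sin_q_neq.
    + exact (sa_q _ _ _ _ _ _ Hs).
  - change ((2 * p t - m1 t) * - (1 + cot (q t) ^ 2)
      = - (1 + cot (q t) ^ 2) * (2 * p t - m1 t)). ring. }
unfold energy.
change (is_derive (fun u => p u ^ 2 - m1 u * p u - xi u * (1 + m2 u * m3 u)
  + m3 u ^ 2 * xi u ^ 2) t 0).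
derive_along. unfold xi. ring.
Qed.

(** All terms in [cot q] and in [m2] cancel; the surviving factor [sin q] is what [angular_bound]
    integrates. *)
Lemma is_derive_angular : is_derive (angular m2 m3 q) t
  (sin (q t) * m3 t * (m1 t - 3 * (2 * p t - m1 t)) / 4).
Proof.
unfold angular. derive_along. rewrite (cos_cot _ sin_q_neq). field.
Qed.

(** For fixed Casimir and energy every term except [2 cos^2 q / sin q] is bounded. *)
Lemma is_derive_radial : is_derive (radial m1 q p) t
  (cos (q t) * (4 * energy m1 m2 m3 q p t + m1 t ^ 2 + m2 t ^ 2 + 3 * m3 t ^ 2)
   + 2 * cos (q t) ^ 2 / sin (q t) - 2 * sin (q t) * (1 + m2 t * m3 t)).
Proof.
unfold radial. derive_along. unfold energy.
rewrite (cos_cot _ sin_q_neq). field. apply sin_q_neq.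
Qed.

(** Completes two squares in the energy, one in [p] and one in [m3 cot q]; the second is the square
    of [m3 cot q - m2 / 2], that is of [W / sin q]. *)
Lemma energy_angular :
  (2 * p t - m1 t) ^ 2 / 4 =
    energy m1 m2 m3 q p t + (m1 t ^ 2 + m2 t ^ 2) / 4 + cot (q t)
    - (angular m2 m3 q t / sin (q t)) ^ 2.
Proof.
unfold energy, angular. rewrite (cos_cot _ sin_q_neq). field. apply sin_q_neq.
Qed.

End Derivatives.

(** * Elementary estimates for small angles *)

Lemma Rabs_le_of_sqr (x y : R) : 0 <= y -> x ^ 2 <= y ^ 2 -> Rabs x <= y.
Proof.
intros Hy Hxy. rewrite <- (Rabs_pos_eq y Hy).
apply Rsqr_le_abs_0. unfold Rsqr. lra.
Qed.

Lemma sin_cos_bounds (x : R) : 0 < x < 1 -> 0 < sin x < x /\ / 2 <= cos x <= 1.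
Proof.
intros Hx. pose proof PI2_3_2.
repeat split.
- apply sin_gt_0; lra.
- apply sin_lt_x; lra.
(* Here [x < 1 < PI / 3], and [cos (PI / 3) = 1 / 2]. *)
- rewrite <- Rdiv_1_l, <- cos_PI3.
  apply cos_decr_1; lra.
- apply COS_bound.
Qed.

Lemma cot_lower_bound (x : R) : 0 < x < 1 -> / (2 * x) <= cot x.
Proof.
intros Hx. destruct (sin_cos_bounds x Hx) as [[Hs Hsx] [Hc _]].
unfold cot, Rdiv. rewrite Rinv_mult.
apply Rmult_le_compat; try lra.
- apply Rlt_le, Rinv_0_lt_compat; lra.
- apply Rinv_le_contravar; lra.
Qed.

(** * Growth of [radial] near the collision *)

Section Collision.

Context (tstar : Rbar) (m1 m2 m3 q p : R -> R).
Context (Hcol : collision_trajectory tstar m1 m2 m3 q p).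

Lemma collision_eventually (eps : R) : 0 < eps ->
  exists T, 0 < T /\ Rbar_lt T tstar /\
    forall t, T <= t -> Rbar_lt t tstar ->
      solves_at m1 m2 m3 q p t /\ q t < eps.
Proof.
intros He.
destruct Hcol as [Hpos Hsol Hlim].
assert (HF : Rbar_at_left tstar (fun t => Rabs (q t) < eps)).
{ apply (Hlim (fun y => Rabs y < eps)).
  exists (mkposreal eps He). intros y Hy.
  change (Rabs (y - 0) < eps) in Hy. now rewrite Rminus_0_r in Hy. }
apply Rbar_at_left_iff in HF; [|exact Hpos].
destruct HF as [T [HT [HTs HP]]].
exists T; split; [exact HT|split; [exact HTs|]].
intros t Ht Hts. split.
- apply (solves_at_interior tstar); auto; lra.
- generalize (HP t Ht Hts). pose proof (Rle_abs (q t)). lra.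
Qed.

(** Later arguments pick such a time instead of passing to the limit at [tstar]. *)
Lemma collision_later (eps T : R) : 0 < eps -> Rbar_lt T tstar ->
  exists t, T <= t /\ Rbar_lt t tstar /\ q t < eps.
Proof.
intros He HTs.
destruct (collision_eventually eps He) as [T' [_ [HTs' HP]]].
assert (Hm : Rbar_lt (Rmax T T') tstar) by (now apply Rmax_case).
exists (Rmax T T'); split; [apply Rmax_l|split; [exact Hm|]].
apply HP; [apply Rmax_r|exact Hm].
Qed.

Record near_collision (C h t : R) : Prop := {
  nc_solves : solves_at m1 m2 m3 q p t;
  nc_casimir : casimir m1 m2 m3 t = C;
  nc_energy : energy m1 m2 m3 q p t = h;
  nc_close : q t < 1;
  nc_radial : exists l, is_derive (radial m1 q p) t l /\ 1 <= l
}.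

Lemma eventually_near_collision : exists C h T, 0 < T /\ Rbar_lt T tstar /\
  forall t, T <= t -> Rbar_lt t tstar -> near_collision C h t.
Proof.
destruct (collision_eventually 1 Rlt_0_1) as [T1 [HT1 [HT1s _]]].
(* The conserved values are read off at an auxiliary time [T1], because the final threshold [T]
   depends on them. *)
pose (C := casimir m1 m2 m3 T1). pose (h := energy m1 m2 m3 q p T1).
assert (HC : 0 <= C) by (unfold C, casimir; nra).
assert (Hsol : forall t, 0 < t -> Rbar_lt t tstar -> solves_at m1 m2 m3 q p t).
{ intros t Ht Hts. apply (solves_at_interior tstar); auto. apply Hcol. }
(* The bounded terms of [G'] are at least [- 4 |h| - (2 + 2 C)], so a singular term of size [K]
   leaves [G' >= 1]. For [q < 1 / (2 K)] it has that size, since [2 cos^2 q >= 1 / 2] and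
   [1 / sin q >= 2 K]. *)
set (K := 4 * Rabs h + 2 * C + 3).
assert (HK : 0 < K) by (unfold K; pose proof (Rabs_pos h); lra).
assert (He : 0 < Rmin 1 (/ (2 * K))).
{ apply Rmin_pos; [lra|]. apply Rinv_0_lt_compat; lra. }
destruct (collision_eventually _ He) as [T [HT [HTs HP]]].
exists C, h, T. split; [exact HT|split; [exact HTs|]].
intros t Ht Hts.
destruct (HP t Ht Hts) as [S Hq].
pose proof (Rmin_l 1 (/ (2 * K))). pose proof (Rmin_r 1 (/ (2 * K))).
assert (EC : casimir m1 m2 m3 t = C).
{ apply (derive_zero_const tstar); auto; [|lra].
  intros u Hu Hus. apply (is_derive_casimir m1 m2 m3 q p). auto. }
assert (Eh : energy m1 m2 m3 q p t = h).
{ apply (derive_zero_const tstar); auto; [|lra].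
  intros u Hu Hus. apply is_derive_energy. auto. }
split; auto; [lra|].
eexists; split; [now apply (is_derive_radial m1 m2 m3 q p)|].
rewrite Eh. unfold casimir in EC.
destruct (sa_range _ _ _ _ _ _ S) as [Hq0 _].
destruct (sin_cos_bounds (q t)) as [[Hs Hsq] Hc]; [lra|].
assert (Hinv : 2 * K <= / sin (q t)).
{ rewrite <- (Rinv_inv (2 * K)). apply Rinv_le_contravar; lra. }
assert (H1 : K <= 2 * cos (q t) ^ 2 / sin (q t)).
{ unfold Rdiv. assert (/ 2 <= 2 * cos (q t) ^ 2) by nra. nra. }
assert (H2 : - (4 * Rabs h) <=
  cos (q t) * (4 * h + m1 t ^ 2 + m2 t ^ 2 + 3 * m3 t ^ 2)).
{ assert (- (cos (q t) * Rabs h) <= cos (q t) * h).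
  { pose proof (Rle_abs (- h)) as Hab. rewrite Rabs_Ropp in Hab. nra. }
  pose proof (Rabs_pos h).
  assert (0 <= cos (q t) * (m1 t ^ 2 + m2 t ^ 2 + 3 * m3 t ^ 2))
    by (apply Rmult_le_pos; nra).
  nra. }
assert (H3 : 2 * sin (q t) * (1 + m2 t * m3 t) <= 2 + 2 * C).
{ assert (m2 t * m3 t <= C) by nra. nra. }
unfold K in H1. lra.
Qed.

(** * Monotone approach and finite collision time *)

Section Near.

Context (C h T : R) (HTs : Rbar_lt T tstar).
Context (Hnear : forall t, T <= t -> Rbar_lt t tstar -> near_collision C h t).

Lemma radial_growth (a b : R) : T <= a -> a <= b -> Rbar_lt b tstar ->
  radial m1 q p a + (b - a) <= radial m1 q p b.
Proof.
intros Ha Hab Hb.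
assert (Hd : forall x, a <= x <= b ->
  exists l, is_derive (radial m1 q p) x l /\ 1 <= l).
{ intros x Hx. apply (nc_radial C h), Hnear; [lra|].
  apply (Rbar_lt_between _ _ b); [lra|exact Hb]. }
enough (radial m1 q p a - a <= radial m1 q p b - b) by lra.
(* The derivative of [G] is known only existentially, so [Derive] supplies it as a function. *)
apply (derive_nonneg_le (fun t => radial m1 q p t - t)
  (fun t => Derive (radial m1 q p) t - 1)); [exact Hab| |].
- intros x Hx. destruct (Hd x Hx) as [l [Dl _]].
  apply (is_derive_minus (radial m1 q p) (fun t => t)).
  + apply Derive_correct. now exists l.
  + apply (is_derive_id (K := R_AbsRing)).
- intros x Hx. destruct (Hd x Hx) as [l [Dl Hl]].
  rewrite (is_derive_unique _ _ _ Dl). lra.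
Qed.

Lemma q_close (t : R) : T <= t -> Rbar_lt t tstar -> 0 < q t < 1.
Proof.
intros Ht Hts. destruct (Hnear t Ht Hts) as [S _ _ Hq _].
destruct (sa_range _ _ _ _ _ _ S). lra.
Qed.

(** A positive value of [G] would persist by [radial_growth]; then [q] could not fall below [q t],
    against the collision. *)
Lemma radial_nonpos (t : R) : T <= t -> Rbar_lt t tstar ->
  radial m1 q p t <= 0.
Proof.
intros Ht Hts.
apply Rnot_lt_le. intros Hpos.
destruct (collision_later (q t) t) as [u [Htu [Hus Hqu]]];
  [now apply q_close|exact Hts|].
apply (Rlt_not_le _ _ Hqu).
apply (derive_nonneg_le q (fun x => 2 * p x - m1 x)); [exact Htu| |];
  intros x Hx; assert (Hxs : Rbar_lt x tstar)
    by (apply (Rbar_lt_between _ _ u); [lra|exact Hus]);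
  assert (HTx : T <= x) by lra.
- apply (sa_q m1 m2 m3 q p). apply (Hnear x HTx Hxs).
- pose proof (radial_growth t x Ht (proj1 Hx) Hxs) as Hg.
  unfold radial in Hg at 2.
  destruct (sin_cos_bounds (q x) (q_close x HTx Hxs)) as [[Hs _] _].
  assert (0 < sin (q x) * (2 * p x - m1 x)) by lra.
  nra.
Qed.

Lemma q_dot_nonpos (t : R) : T <= t -> Rbar_lt t tstar ->
  2 * p t - m1 t <= 0.
Proof.
intros Ht Hts. pose proof (radial_nonpos t Ht Hts) as Hr. unfold radial in Hr.
destruct (sin_cos_bounds (q t) (q_close t Ht Hts)) as [[Hs _] _]. nra.
Qed.

Lemma q_decreasing (a b : R) : T <= a -> a <= b -> Rbar_lt b tstar -> q b <= q a.
Proof.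
intros Ha Hab Hb. apply Ropp_le_cancel.
apply (derive_nonneg_le (fun x => - q x) (fun x => - (2 * p x - m1 x)));
  [exact Hab| |];
  intros x Hx; assert (Hxs : Rbar_lt x tstar)
    by (apply (Rbar_lt_between _ _ b); [lra|exact Hb]);
  assert (HTx : T <= x) by lra.
- apply (is_derive_opp q). apply (sa_q m1 m2 m3 q p). apply (Hnear x HTx Hxs).
- pose proof (q_dot_nonpos x HTx Hxs). lra.
Qed.

(** [G] grows at least at unit rate and never exceeds zero; this excludes an infinite collision
    time. *)
Lemma collision_time_bound (t : R) : T <= t -> Rbar_lt t tstar ->
  t <= T - radial m1 q p T.
Proof.
intros Ht Hts.
pose proof (radial_growth T t (Rle_refl T) Ht Hts).
pose proof (radial_nonpos t Ht Hts). lra.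
Qed.

(** * Bounds on the angular quantity *)

Lemma casimir_bounds (t : R) : T <= t -> Rbar_lt t tstar ->
  0 <= C /\ Rabs (m1 t) <= 1 + C /\ Rabs (m3 t) <= 1 + C /\
  m1 t ^ 2 + m2 t ^ 2 <= C.
Proof.
intros Ht Hts. pose proof (nc_casimir _ _ _ (Hnear t Ht Hts)) as E.
unfold casimir in E.
assert (HC : 0 <= C) by nra.
(* The bound [1 + C] avoids a square root, as [C <= (1 + C)^2]. *)
repeat split; try apply Rabs_le_of_sqr; nra.
Qed.

(** Dropping [q'^2] in [energy_angular] and multiplying by [sin^2 q] gives [W^2 <= K sin q], which
    is at most [eps^2] once [q < eps^2 / K]. *)
Lemma angular_small_later (eps t : R) : 0 < eps -> T <= t -> Rbar_lt t tstar ->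
  exists u, t <= u /\ Rbar_lt u tstar /\ Rabs (angular m2 m3 q u) <= eps.
Proof.
intros He Ht Hts.
destruct (casimir_bounds t Ht Hts) as [HC _].
set (K := Rabs h + C + 1).
assert (HK : 0 < K) by (unfold K; pose proof (Rabs_pos h); lra).
destruct (collision_later (eps ^ 2 / K) t) as [u [Htu [Hus Hqu]]];
  [apply Rdiv_lt_0_compat; nra|exact Hts|].
exists u; split; [exact Htu|split; [exact Hus|]].
assert (HTu : T <= u) by lra.
apply Rabs_le_of_sqr; [lra|].
destruct (casimir_bounds u HTu Hus) as [_ [_ [_ HC12]]].
destruct (sin_cos_bounds (q u) (q_close u HTu Hus)) as [[Hs Hsq] Hc].
pose proof (q_close u HTu Hus).
pose proof (energy_angular _ _ _ _ _ _ (nc_solves _ _ _ (Hnear u HTu Hus))) as E.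
rewrite (nc_energy _ _ _ (Hnear u HTu Hus)) in E.
assert (Hle : (angular m2 m3 q u / sin (q u)) ^ 2 <= Rabs h + C + cot (q u)).
{ pose proof (Rle_abs h). pose proof (pow2_ge_0 (2 * p u - m1 u)). lra. }
replace (angular m2 m3 q u ^ 2)
  with (sin (q u) ^ 2 * (angular m2 m3 q u / sin (q u)) ^ 2) by (field; lra).
apply Rle_trans with (sin (q u) ^ 2 * (Rabs h + C + cot (q u))).
{ apply Rmult_le_compat_l; [nra|exact Hle]. }
apply Rle_trans with (sin (q u) * K).
- replace (sin (q u) ^ 2 * (Rabs h + C + cot (q u)))
    with (sin (q u) * (sin (q u) * (Rabs h + C) + cos (q u)))
    by (unfold cot; field; lra).
  apply Rmult_le_compat_l; [lra|]. unfold K.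
  pose proof (Rabs_pos h). nra.
- apply Rle_trans with (eps ^ 2 / K * K); [|right; field; lra].
  apply Rmult_le_compat_r; lra.
Qed.

(** On [[t, u]] the variation of [W] is at most that of a majorant [A], and [W u] can be made
    arbitrarily small. *)
Lemma angular_bound : exists K, 0 <= K /\
  forall t, T <= t -> Rbar_lt t tstar ->
    Rabs (angular m2 m3 q t) <= K * sin (q t).
Proof.
(* [B] bounds [m1] and [m3], and [D] bounds the time from [T] to the collision. *)
set (B := 1 + C). set (D := - radial m1 q p T).
pose proof (collision_time_bound T (Rle_refl T) HTs) as HD.
assert (HD0 : 0 <= D) by (unfold D; lra).
exists (B ^ 2 * (D + 1)). split; [nra|].
intros t Ht Hts.
destruct (sin_cos_bounds (q t) (q_close t Ht Hts)) as [[Hs _] _].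
(* The factor [sin q] of [W'] is frozen at its largest value, the one at the initial time [t]. Since
   [- q' >= 0], the term [- q u] integrates [|q'|]. *)
set (A := fun u => B ^ 2 * sin (q t) * (u - q u)).
assert (Hd : forall x, t <= x -> Rbar_lt x tstar ->
  exists dW dA, is_derive (angular m2 m3 q) x dW /\ is_derive A x dA /\
    Rabs dW <= dA).
{ intros x Hx Hxs. assert (HTx : T <= x) by lra.
  pose proof (nc_solves _ _ _ (Hnear x HTx Hxs)) as Sx.
  eexists; exists (B ^ 2 * sin (q t) * (1 - (2 * p x - m1 x))).
  split; [now apply (is_derive_angular m1 m2 m3 q p)|].
  split.
  - unfold A. apply (is_derive_scal (fun u => u - q u)).
    apply (is_derive_minus (fun u => u) q).
    + apply (is_derive_id (K := R_AbsRing)).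
    + now apply (sa_q m1 m2 m3 q p).
  - destruct (casimir_bounds x HTx Hxs) as [HC [H1 [H3 _]]].
    fold B in H1, H3.
    assert (HB : 1 <= B) by (unfold B; lra).
    pose proof (q_dot_nonpos x HTx Hxs) as Hq.
    destruct (sin_cos_bounds (q x) (q_close x HTx Hxs)) as [[Hsx _] _].
    assert (Hsin : sin (q x) <= sin (q t)).
    { pose proof (q_close x HTx Hxs). pose proof (q_close t Ht Hts).
      pose proof PI2_3_2.
      apply sin_incr_1; try lra. now apply q_decreasing. }
    (* As [q' <= 0] and [B >= 1], the left side is at most [B - 3 q' <= 4 B (1 - q')]. *)
    assert (H13 : Rabs (m1 x - 3 * (2 * p x - m1 x))
                  <= 4 * (B * (1 - (2 * p x - m1 x)))).
    { apply Rabs_le_between in H1. apply Rabs_le_between. nra. }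
    unfold Rdiv. rewrite !Rabs_mult, (Rabs_pos_eq (sin (q x))), (Rabs_pos_eq (/ 4)) by lra.
    replace (B ^ 2 * sin (q t) * (1 - (2 * p x - m1 x)))
      with (sin (q t) * B * (4 * (B * (1 - (2 * p x - m1 x)))) * / 4) by field.
    apply Rmult_le_compat_r; [lra|].
    apply Rmult_le_compat; try apply Rabs_pos; try exact H13.
    + apply Rmult_le_pos; [lra|apply Rabs_pos].
    + apply Rmult_le_compat; try apply Rabs_pos; lra. }
apply Rle_plus_epsilon. intros eps He.
destruct (angular_small_later eps t He Ht Hts) as [u [Htu [Hus Hu]]].
assert (Hd' : forall x, t <= x <= u ->
  ex_derive (angular m2 m3 q) x /\ ex_derive A x /\
    Rabs (Derive (angular m2 m3 q) x) <= Derive A x).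
{ intros x Hx. destruct (Hd x) as [dW [dA [DW [DA Hle]]]]; [lra| |].
  - apply (Rbar_lt_between _ _ u); [lra|exact Hus].
  - split; [now exists dW|split; [now exists dA|]].
    now rewrite (is_derive_unique _ _ _ DW), (is_derive_unique _ _ _ DA). }
assert (Hplus : A t + angular m2 m3 q t <= A u + angular m2 m3 q u).
{ apply (derive_nonneg_le (fun x => A x + angular m2 m3 q x)
    (fun x => Derive A x + Derive (angular m2 m3 q) x)); [exact Htu| |].
  - intros x Hx. destruct (Hd' x Hx) as [EW [EA _]].
    apply (is_derive_plus A (angular m2 m3 q)); now apply Derive_correct.
  - intros x Hx. destruct (Hd' x Hx) as [_ [_ Hle]].
    apply Rabs_le_between in Hle. lra. }
assert (Hminus : A t - angular m2 m3 q t <= A u - angular m2 m3 q u).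
{ apply (derive_nonneg_le (fun x => A x - angular m2 m3 q x)
    (fun x => Derive A x - Derive (angular m2 m3 q) x)); [exact Htu| |].
  - intros x Hx. destruct (Hd' x Hx) as [EW [EA _]].
    apply (is_derive_minus A (angular m2 m3 q)); now apply Derive_correct.
  - intros x Hx. destruct (Hd' x Hx) as [_ [_ Hle]].
    apply Rabs_le_between in Hle. lra. }
(* The elapsed time contributes at most [D], the decrease of [q] at most [1]. *)
assert (HA : A u - A t <= B ^ 2 * (D + 1) * sin (q t)).
{ unfold A.
  replace (B ^ 2 * sin (q t) * (u - q u) - B ^ 2 * sin (q t) * (t - q t))
    with (B ^ 2 * sin (q t) * ((u - t) + (q t - q u))) by ring.
  replace (B ^ 2 * (D + 1) * sin (q t)) with (B ^ 2 * sin (q t) * (D + 1)) by ring.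
  assert (HTu : T <= u) by lra.
  pose proof (q_close u HTu Hus). pose proof (q_close t Ht Hts).
  pose proof (collision_time_bound u HTu Hus).
  apply Rmult_le_compat_l; [nra|]. unfold D. lra. }
apply Rabs_le_between in Hu. apply Rabs_le_between. lra.
Qed.

(** By [angular_bound] the subtracted square in [energy_angular] is bounded, so nothing offsets the
    growth of [cot q]. *)
Lemma q_dot_sqr_bound : exists K,
  forall t, T <= t -> Rbar_lt t tstar ->
    cot (q t) - K <= (2 * p t - m1 t) ^ 2 / 4.
Proof.
destruct angular_bound as [K [HK HW]].
exists (K ^ 2 - h). intros t Ht Hts.
rewrite (energy_angular _ _ _ _ _ _ (nc_solves _ _ _ (Hnear t Ht Hts))).
rewrite (nc_energy _ _ _ (Hnear t Ht Hts)).
destruct (sin_cos_bounds (q t) (q_close t Ht Hts)) as [[Hs _] _].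
assert (HWs : (angular m2 m3 q t / sin (q t)) ^ 2 <= K ^ 2).
{ apply pow_maj_Rabs. rewrite Rabs_div, (Rabs_pos_eq (sin (q t))) by lra.
  apply Rle_div_l; [lra|]. now apply HW. }
nra.
Qed.

End Near.

(** * Divergence of the velocity and of [p] *)

Lemma q_dot_eventually_below (M : R) : exists T, 0 < T /\ Rbar_lt T tstar /\
  forall t, T <= t -> Rbar_lt t tstar ->
    2 * p t - m1 t < M /\ p t < M /\ is_derive q t (2 * p t - m1 t).
Proof.
destruct eventually_near_collision as [C [h [T [HT [HTs Hnear]]]]].
destruct (q_dot_sqr_bound C h T HTs Hnear) as [K HK].
destruct (casimir_bounds C h T Hnear T (Rle_refl T) HTs) as [HC _].
(* From [q' < - N] and [m1 <= 1 + C] one gets [2 p = q' + m1 < - 2 |M|], hence [p < M]. *)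
set (N := 2 * Rabs M + C + 1).
assert (HN : 1 <= N) by (unfold N; pose proof (Rabs_pos M); lra).
(* If [cot q >= L] then [q'^2 / 4 >= N^2], and [q' <= 0] selects [q' < - N]. The threshold
   [q < 1 / (2 L)] matches [cot_lower_bound]. *)
set (L := N ^ 2 + Rabs K).
assert (HL : 0 < L) by (unfold L; pose proof (Rabs_pos K); nra).
destruct (collision_eventually (/ (2 * L))) as [T' [HT' [HTs' HP]]].
{ apply Rinv_0_lt_compat; lra. }
exists (Rmax T T'). split; [now apply Rmax_case|].
split; [now apply Rmax_case|].
intros t Ht Hts.
assert (H1 : T <= t) by (pose proof (Rmax_l T T'); lra).
assert (H2 : T' <= t) by (pose proof (Rmax_r T T'); lra).
destruct (HP t H2 Hts) as [S Hq].
pose proof (q_close C h T Hnear t H1 Hts) as Hq1.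
pose proof (HK t H1 Hts) as Hsq.
pose proof (q_dot_nonpos C h T Hnear t H1 Hts) as Hneg.
destruct (casimir_bounds C h T Hnear t H1 Hts) as [_ [Hm1 _]].
assert (Hcot : L <= cot (q t)).
{ apply Rle_trans with (2 := cot_lower_bound _ Hq1).
  rewrite Rinv_mult.
  assert (2 * L <= / q t).
  { rewrite <- (Rinv_inv (2 * L)). apply Rinv_le_contravar; lra. }
  lra. }
assert (Hlt : 2 * p t - m1 t < - N).
{ pose proof (Rle_abs K). unfold L in Hcot. nra. }
apply Rabs_le_between in Hm1.
pose proof (Rle_abs (- M)) as HM. rewrite Rabs_Ropp in HM.
unfold N in Hlt. pose proof (Rabs_pos M).
split; [lra|split; [lra|]].
now apply (sa_q m1 m2 m3 q p).
Qed.

End Collision.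

Theorem proposition3p11 :
  forall (tstar : Rbar) (m1 m2 m3 q p : R -> R),
    collision_trajectory tstar m1 m2 m3 q p ->
    filterlim (Derive q) (Rbar_at_left tstar) (Rbar_locally m_infty) /\
    filterlim p (Rbar_at_left tstar) (Rbar_locally m_infty).
Proof.
intros tstar m1 m2 m3 q p Hcol.
split; intros P [M HM]; unfold filtermap;
  apply Rbar_at_left_iff; try apply Hcol;
  destruct (q_dot_eventually_below tstar m1 m2 m3 q p Hcol M)
    as [T [HT [HTs Hlt]]];
  exists T; split; auto; split; auto; intros t Ht Hts; apply HM;
  destruct (Hlt t Ht Hts) as [H1 [H2 H3]].
- now rewrite (is_derive_unique _ _ _ H3).
- exact H2.
Qed.
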